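(* Let $N\ge2$, let $\mathbf{z}=(z_1>\cdots>z_N)$, let $\mathsf{a}_1=\cdots=\mathsf{a}_{N-1}$ be real with $\mathsf{a}_N\in\mathbb{R}$ arbitrary, and set $\mathsf{c}=\mathsf{a}_{N-1}-\mathsf{a}_N$. Let $P_N(x)=\prod_{j=1}^N(x-z_j)$, and let $P_{N-1}$ be the monic polynomial of degree $N-1$ whose roots are the $N-1$ interlacing roots of $D_{\mathsf{c}}P_N=P_N'+\mathsf{c}P_N$. Let $\{\bar{\mathsf{y}}_i^k\}$ be the deformed $\infty$-corners lattice with top row $\mathbf{z}$ and parameters $\mathsf{a}=(\mathsf{a}_1,\ldots,\mathsf{a}_N)$. Then, for each $k=1,\ldots,N-1$, the level-$k$ positions $\bar{\mathsf{y}}_1^k>\cdots>\bar{\mathsf{y}}_k^k$ are the roots of $\left(\frac{d}{dx}\right)^{N-1-k}P_{N-1}$. Equivalently, the levels $N-1,\ldots,1$ of the deformed lattice form the $\infty$-corners lattice whose top row consists of the roots of $P_{N-1}$. For $\mathsf{c}=0$ we have $P_{N-1}=P_N'/N$, and the deformed lattice is the (unperturbed) $\infty$-corners lattice with top row $\mathbf{z}$.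
   Context: Interlacing roots: for $P_N(x)=\prod_{j=1}^N(x-z_j)$ with $z_1>\cdots>z_N$ and any $\mathsf{c}\in\mathbb{R}$, the polynomial $D_{\mathsf{c}}P_N=P_N'+\mathsf{c}P_N$ has exactly one root in each open interval $(z_{j+1},z_j)$, $j=1,\ldots,N-1$; these $N-1$ roots are its interlacing roots. $\infty$-corners lattice with top row $\mathbf{w}=(w_1>\cdots>w_n)$: level $n$ is $\mathbf{w}$, and for $k=n-1,\ldots,1$ level $k$ consists of the $k$ roots, in decreasing order, of $\left(\frac{d}{du}\right)^{n-k}\prod_{j=1}^n(u-w_j)$. Deformed $\infty$-corners lattice with top row $\mathbf{z}$ and parameters $\mathsf{a}=(\mathsf{a}_1,\ldots,\mathsf{a}_N)$: $\bar{\mathsf{y}}_i^N=z_i$, and $\{\bar{\mathsf{y}}_i^k\}_{1\le i\le k\le N-1}$ is the unique solution of $$\sum_{\substack{1\le j\le k\\ j\ne i}}\frac{1}{\bar{\mathsf{y}}_i^k-\bar{\mathsf{y}}_j^k}-\frac12\sum_{q=1}^{k+1}\frac{1}{\bar{\mathsf{y}}_i^k-\bar{\mathsf{y}}_q^{k+1}}-\frac12\sum_{p=1}^{k-1}\frac{1}{\bar{\mathsf{y}}_i^k-\bar{\mathsf{y}}_p^{k-1}}=\frac{\mathsf{a}_k-\mathsf{a}_{k+1}}{2},\qquad 1\le i\le k\le N-1,$$ subject to strict interlacing $\bar{\mathsf{y}}_1^{k+1}>\bar{\mathsf{y}}_1^k>\bar{\mathsf{y}}_2^{k+1}>\cdots>\bar{\mathsf{y}}_k^k>\bar{\mathsf{y}}_{k+1}^{k+1}$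 for all $1\le k\le N-1$. (Existence and uniqueness hold for every real $\mathbf{z}=(z_1>\cdots>z_N)$ and every $\mathsf{a}\in\mathbb{R}^N$.) *)

(* Defs.v *)
From mathcomp Require Import all_boot all_order all_algebra.
From mathcomp Require Import reals.

Set Implicit Arguments.
Unset Strict Implicit.
Unset Printing Implicit Defensive.

Import Order.TTheory GRing.Theory Num.Theory.
Local Open Scope ring_scope.

(* Rows (x_1, ..., x_n) are functions [nat -> R] indexed from 1, and triangular
   arrays are functions [y : nat -> nat -> R] where [y k i] is the i-th entry of
   level k. Only the values at 1 <= i <= n (resp. 1 <= i <= k) are ever used. *)

Definition strictly_decreasing (R : realType) (n : nat) (x : nat -> R) : Prop :=
  forall j : nat, (1 <= j < n)%N -> x j.+1 < x j.

Definition row_poly (R : realType) (n : nat) (x : nat -> R) : {poly R} :=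
  \prod_(1 <= j < n.+1) ('X - (x j)%:P).

Definition Dop (R : realType) (c : R) (p : {poly R}) : {poly R} :=
  p^`() + c *: p.

Definition interlacing_roots (R : realType) (N : nat) (z : nat -> R) (c : R)
    (v : nat -> R) : Prop :=
  forall j : nat, (1 <= j < N)%N ->
    z j.+1 < v j < z j /\ root (Dop c (row_poly N z)) (v j).

(* The set of all real roots of [p] is {x_1 > ... > x_k}. Below, [p] has degree
   k, so that these are all its roots and they are simple. *)
Definition decreasing_roots (R : realType) (k : nat) (p : {poly R})
    (x : nat -> R) : Prop :=
  strictly_decreasing k x /\
  (forall u : R, root p u <-> exists2 j : nat, (1 <= j <= k)%N & u = x j).

Definition corners_lattice (R : realType) (n : nat) (w : nat -> R)
    (y : nat -> nat -> R) : Prop :=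
  [/\ strictly_decreasing n w,
      forall i : nat, (1 <= i <= n)%N -> y n i = w i
    & forall k : nat, (1 <= k < n)%N ->
        decreasing_roots k ((row_poly n w)^`(n - k)) (y k)].

(* Strict interlacing makes every denominator below nonzero; for k = 1 the sum
   over level k - 1 is empty. *)
Definition deformed_corners_lattice (R : realType) (N : nat) (z a : nat -> R)
    (y : nat -> nat -> R) : Prop :=
  [/\ forall i : nat, (1 <= i <= N)%N -> y N i = z i,
      forall k i : nat, (1 <= i <= k)%N -> (k < N)%N ->
        y k.+1 i.+1 < y k i < y k.+1 i
    & forall k i : nat, (1 <= i <= k)%N -> (k < N)%N ->
        (\sum_(1 <= j < k.+1 | j != i) (y k i - y k j)^-1)
        - 2^-1 * (\sum_(1 <= q < k.+2) (y k i - y k.+1 q)^-1)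
        - 2^-1 * (\sum_(1 <= p < k) (y k i - y k.-1 p)^-1)
        = (a k - a k.+1) / 2].

(* Main.v *)
Require Import Defs.
From mathcomp Require Import all_boot all_order all_algebra.
From mathcomp Require Import reals.
From mathcomp Require Import zify ring lra.

Set Implicit Arguments.
Unset Strict Implicit.
Unset Printing Implicit Defensive.

Import Order.TTheory GRing.Theory Num.Theory.
Local Open Scope ring_scope.

(** Write [Q_k] for the monic polynomial whose roots are level [k] of the lattice,
    and [c_k = a_k - a_(k+1)]. At a simple root [u] of [Q_k], the sum of the
    [1 / (u - y_j^k)] over the other roots is [Q_k''(u) / (2 Q_k'(u))], so the
    lattice equations say
      [Q_k'' / Q_k' - Q_(k+1)' / Q_(k+1) - Q_(k-1)' / Q_(k-1) = c_k]
    at every root of [Q_k].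

    These equations can be solved from the bottom upwards. Level 0 is empty, so
    at [k = 1] the first and third terms vanish. Inductively, if
    [Q_k' = k Q_(k-1)], then the first and third terms are equal
    ([sum_inv_at_root]) and cancel. What remains is [Q_(k+1)' + c_k Q_(k+1) = 0]
    at the roots of [Q_k] ([lattice_root_Dop]). When [c_k = 0], the polynomials
    [Q_(k+1)'] and [(k+1) Q_k] have the same degree, the same leading coefficient
    and the same [k] distinct roots, so they are equal, and the induction goes on
    ([lattice_deriv]).

    As [a_1 = ... = a_(N-1)], this gives [Q_(k+1)' = (k+1) Q_k] for [k < N-1], so
    every lower [Q_k] is a scalar multiple of a derivative of [Q_(N-1)]. At
    [k = N-1] the same cancellation shows that level [N-1] consists of roots of
    [P_N' + c P_N] interlacing with [z]. Since [P_N' / P_N] is injective on each interval between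
    consecutive [z_j], these roots are the [v_j] ([interlacing_root_unique]).
    When [c = 0], the induction also covers [k = N-1], which puts [P_N] itself on
    top of the chain of derivatives. *)

(** * Interlacing rows *)

Definition interlaces (R : realType) (n : nat) (x w : nat -> R) : Prop :=
  forall i : nat, (1 <= i < n)%N -> x i.+1 < w i < x i.

Lemma strictly_decreasing_lt (R : realType) (n : nat) (x : nat -> R) i j :
  strictly_decreasing n x -> (1 <= i)%N -> (i < j <= n)%N -> x j < x i.
Proof.
move=> dec i_gt0 /andP[]; elim: j => // j IHj; rewrite ltnS leq_eqVlt.
case/predU1P => [<- i_lt|i_lt j_lt]; first by apply: dec; rewrite i_gt0.
apply: lt_trans (IHj i_lt (ltnW j_lt)); apply: dec.
by rewrite j_lt (leq_trans i_gt0 (ltnW i_lt)).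
Qed.

Lemma strictly_decreasing_eq (R : realType) (n : nat) (x : nat -> R) i j :
  strictly_decreasing n x -> (1 <= i <= n)%N -> (1 <= j <= n)%N ->
  (x i == x j) = (i == j).
Proof.
move=> dec /andP[i0 iN] /andP[j0 jN]; case: (ltngtP i j) => [ij|ji|->].
- by rewrite gt_eqF// (strictly_decreasing_lt dec)// ij.
- by rewrite lt_eqF// (strictly_decreasing_lt dec)// ji.
- by rewrite eqxx.
Qed.

Lemma interlaces_strictly_decreasing (R : realType) (n : nat) (x w : nat -> R) :
  interlaces n x w -> strictly_decreasing n x.
Proof. by move=> xw j /xw/andP[]; exact: lt_trans. Qed.

Lemma interlaces_strictly_decreasing_lower (R : realType) (n : nat)
    (x w : nat -> R) :
  interlaces n x w -> strictly_decreasing n.-1 w.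
Proof.
move=> xw j jn; have /andP[_ wx] := xw j.+1 ltac:(lia).
by have /andP[xw' _] := xw j ltac:(lia); exact: lt_trans wx xw'.
Qed.

(** The entry [w i] splits the row [x] between the positions [i] and [i+1]; in
    particular the sign of [w i - x q] depends only on [i] and [q], and so is the
    same for all rows interlacing with [x]. *)
Lemma interlaces_cmp (R : realType) (n : nat) (x w : nat -> R) i q :
  interlaces n x w -> (1 <= i < n)%N -> (1 <= q <= n)%N ->
  if (q <= i)%N then w i < x q else x q < w i.
Proof.
move=> xw iN qN; have dec := interlaces_strictly_decreasing xw.
have /andP[lo hi] := xw i iN; case: leqP => [|iq].
  rewrite leq_eqVlt => /predU1P[->//|qi].
  by apply: lt_trans hi _; apply: (strictly_decreasing_lt dec); lia.
case: (ltngtP i.+1 q) => [iq'||<-//]; last by lia.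
by apply: lt_trans lo; apply: (strictly_decreasing_lt dec); lia.
Qed.

Lemma interlaces_neq (R : realType) (n : nat) (x w : nat -> R) i q :
  interlaces n x w -> (1 <= i < n)%N -> (1 <= q <= n)%N -> w i != x q.
Proof.
move=> xw iN qN; have := interlaces_cmp xw iN qN.
by case: ifP => _ => [/lt_eqF->|/gt_eqF->].
Qed.

(** * Monic polynomials with prescribed roots *)

Lemma root_row_poly (R : realType) (n : nat) (x : nat -> R) (u : R) :
  reflect (exists2 j : nat, (1 <= j <= n)%N & u = x j)
          (root (row_poly n x) u).
Proof.
have -> : row_poly n x = \prod_(a <- map x (index_iota 1 n.+1)) ('X - a%:P).
  by rewrite big_map.
rewrite root_prod_XsubC.
by apply: (iffP mapP) => -[j jn ->]; exists j; move: jn; rewrite ?mem_index_iota.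
Qed.

Lemma row_poly_horner_neq0 (R : realType) (n : nat) (x : nat -> R) (u : R) :
  (forall j, (1 <= j <= n)%N -> u != x j) -> (row_poly n x).[u] != 0.
Proof.
by move=> ux; apply/root_row_poly => -[j /ux/eqP].
Qed.

Lemma eq_row_poly (R : realType) (n : nat) (x w : nat -> R) :
  (forall i, (1 <= i <= n)%N -> x i = w i) -> row_poly n x = row_poly n w.
Proof. by move=> xw; apply: eq_big_nat => i /xw->. Qed.

Lemma size_row_poly (R : realType) (n : nat) (x : nat -> R) :
  size (row_poly n x) = n.+1.
Proof. by rewrite /row_poly size_prod_XsubC size_iota subn1. Qed.

Lemma row_poly_lead (R : realType) (n : nat) (x : nat -> R) :
  (row_poly n x)`_n = 1.
Proof.
have := monic_prod_XsubC (index_iota 1 n.+1) xpredT x.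
by rewrite -/(row_poly n x) => /monicP; rewrite /lead_coef size_row_poly.
Qed.

Lemma horner_deriv_prod_XsubC (F : fieldType) (I : Type) (r : seq I)
    (P : pred I) (x : I -> F) (u : F) :
  (\prod_(i <- r | P i) ('X - (x i)%:P)).[u] != 0 ->
  (\prod_(i <- r | P i) ('X - (x i)%:P))^`().[u]
  = (\prod_(i <- r | P i) ('X - (x i)%:P)).[u]
    * \sum_(i <- r | P i) (u - x i)^-1.
Proof.
elim: r => [|i r IHr].
  by rewrite !big_nil derivC horner0 mulr0.
rewrite !big_cons; case: ifP => // _.
rewrite hornerM !hornerE mulf_eq0 => /norP[ui /IHr eq_r].
by rewrite derivM derivXsubC !hornerE eq_r; field.
Qed.

Lemma horner_deriv_row_poly (R : realType) (n : nat) (x : nat -> R) (u : R) :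
  (forall j, (1 <= j <= n)%N -> u != x j) ->
  (row_poly n x)^`().[u]
  = (row_poly n x).[u] * \sum_(1 <= j < n.+1) (u - x j)^-1.
Proof.
by move=> ux; exact: horner_deriv_prod_XsubC (row_poly_horner_neq0 ux).
Qed.

(** [p' + c p = p (p' / p + c)], and the logarithmic derivative [p' / p] is the
    sum of the [1 / (u - x_j)]. *)
Lemma root_Dop_row_poly (R : realType) (n : nat) (x : nat -> R) (c u : R) :
  (forall j, (1 <= j <= n)%N -> u != x j) ->
  root (Dop c (row_poly n x)) u = (\sum_(1 <= j < n.+1) (u - x j)^-1 == - c).
Proof.
move=> ux; rewrite /Dop rootE hornerD hornerZ horner_deriv_row_poly//.
rewrite mulrC -mulrDl mulf_eq0 (negPf (row_poly_horner_neq0 ux)) orbF.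
by rewrite addr_eq0.
Qed.

(** Each [1 / (u - x_j)] is strictly decreasing in [u] as long as [u - x_j] keeps
    its sign, so the logarithmic derivative takes the value [-c] at most once
    between two consecutive entries of [x]. *)
Lemma interlacing_root_unique (R : realType) (n : nat) (x v w : nat -> R)
    (c : R) :
  interlaces n x v -> interlaces n x w ->
  (forall i, (1 <= i < n)%N -> root (Dop c (row_poly n x)) (v i)) ->
  (forall i, (1 <= i < n)%N -> root (Dop c (row_poly n x)) (w i)) ->
  forall i, (1 <= i < n)%N -> v i = w i.
Proof.
move=> xv xw rv rw i iN.
have sumE t : interlaces n x t ->
    (forall i, (1 <= i < n)%N -> root (Dop c (row_poly n x)) (t i)) ->
    \sum_(1 <= j < n.+1) (t i - x j)^-1 = - c.
  move=> xt /(_ i iN); rewrite root_Dop_row_poly => [/eqP//|j jn].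
  exact: interlaces_neq jn.
have mono s t : interlaces n x s -> interlaces n x t -> s i < t i ->
    \sum_(1 <= j < n.+1) (t i - x j)^-1 < \sum_(1 <= j < n.+1) (s i - x j)^-1.
  move=> xs xt st; apply: ltr_sum_nat => [|j jn]; first by lia.
  have := interlaces_cmp xs iN jn; have := interlaces_cmp xt iN jn.
  case: ifP => _ tj sj.
    by rewrite ltf_nV2 ?negrE ?subr_lt0// ltrD2r.
  by rewrite ltf_pV2 ?posrE ?subr_gt0// ltrD2r.
case: (ltgtP (v i) (w i)) => // [/(mono _ _ xv xw)|/(mono _ _ xw xv)];
  by rewrite (sumE v)// (sumE w)// ltxx.
Qed.

(** Write [p] for the polynomial of the row [x], and [p = (X - x_i) q]. Then
    [p'(x_i) = q(x_i)] and [p''(x_i) = 2 q'(x_i)], so at [x_i] the logarithmic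
    derivative of [p'] is twice that of [q]. The former is the left-hand side,
    because [p'] is a scalar multiple of the polynomial of the row [w]. *)
Lemma sum_inv_at_root (R : realType) (k : nat) (x w : nat -> R) (b : R) i :
  strictly_decreasing k x -> b != 0 ->
  (row_poly k x)^`() = b *: row_poly k.-1 w ->
  (1 <= i <= k)%N ->
  \sum_(1 <= p < k) (x i - w p)^-1
  = 2 * \sum_(1 <= j < k.+1 | j != i) (x i - x j)^-1.
Proof.
move=> dec b0 Dx ik; set s := \sum_(_ <= j < _ | j != i) _.
pose q := \prod_(1 <= j < k.+1 | j != i) ('X - (x j)%:P).
have xE : row_poly k x = ('X - (x i)%:P) * q.
  by rewrite /row_poly (bigD1_seq i) ?iota_uniq// mem_index_iota.
have q0 : q.[x i] != 0.
  rewrite /q horner_prod prodf_seq_neq0; apply/allP => j.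
  rewrite mem_index_iota hornerXsubC subr_eq0 => jk.
  by apply/implyP; rewrite (strictly_decreasing_eq dec ik)// eq_sym.
have Dq : q^`().[x i] = q.[x i] * s by exact: horner_deriv_prod_XsubC q0.
have D1 : b * (row_poly k.-1 w).[x i] = q.[x i].
  by rewrite -hornerZ -Dx xE derivM derivXsubC !hornerE subrr; ring.
have D2 : b * (row_poly k.-1 w)^`().[x i] = 2 * q^`().[x i].
  have := congr1 (fun p : {poly R} => p^`().[x i]) Dx.
  rewrite derivZ hornerZ => <-; rewrite xE derivM derivXsubC mul1r derivD derivM.
  rewrite derivXsubC mul1r !hornerD hornerM hornerXsubC subrr.
  by rewrite mul0r addr0 mulr_natl mulr2n.
have w0 : (row_poly k.-1 w).[x i] != 0.
  by apply: contraNneq q0 => w0; rewrite -D1 w0 mulr0.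
have := horner_deriv_prod_XsubC w0; rewrite -/(row_poly k.-1 w).
rewrite prednK; last by lia.
move=> Dw; apply: (mulfI (mulf_neq0 b0 w0)).
by rewrite -mulrA -Dw D2 Dq D1; ring.
Qed.

(** Both sides have degree [k] and leading coefficient [k+1], so their difference
    has degree less than [k], yet it vanishes at the [k] distinct points [w_i]. *)
Lemma deriv_row_poly_eq (R : realType) (k : nat) (x w : nat -> R) :
  strictly_decreasing k w ->
  (forall i, (1 <= i <= k)%N -> root (row_poly k.+1 x)^`() (w i)) ->
  (row_poly k.+1 x)^`() = k.+1%:R *: row_poly k w.
Proof.
move=> dec rw; apply/eqP; rewrite -subr_eq0; apply/eqP.
apply: (@roots_geq_poly_eq0 _ _ [seq w i | i <- index_iota 1 k.+1]).
- apply/allP => _ /mapP[i + ->]; rewrite mem_index_iota => ik.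
  have /rootP rxi := rw _ ik; rewrite rootE !hornerE rxi.
  have /rootP -> : root (row_poly k w) (w i) by apply/root_row_poly; exists i.
  by rewrite mulr0 subrr.
- rewrite map_inj_in_uniq ?iota_uniq// => i j.
  rewrite !mem_index_iota => ik jk /eqP.
  by rewrite (strictly_decreasing_eq dec)// => /eqP.
- rewrite size_map size_iota subn1 /=; apply/leq_sizeP => j.
  rewrite leq_eqVlt coefB coefZ coef_deriv => /predU1P[<-|kj].
    by rewrite !row_poly_lead mulr1 subrr.
  by rewrite !nth_default ?size_row_poly// mul0rn mulr0 subrr.
Qed.

(** * Chains of derivatives *)

Lemma derivn_row_poly_chain (R : realType) (M k : nat) (y : nat -> nat -> R) :
  (forall m, (k <= m < M)%N ->
     (row_poly m.+1 (y m.+1))^`() = m.+1%:R *: row_poly m (y m)) ->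
  (k <= M)%N ->
  exists2 b : R, b != 0 &
    (row_poly M (y M))^`(M - k) = b *: row_poly k (y k).
Proof.
move=> chain; elim: M chain => [|M IHM] chain.
  by rewrite leqn0 => /eqP->; exists 1; rewrite ?oner_neq0// scale1r.
rewrite leq_eqVlt => /predU1P[->|kM].
  by exists 1; rewrite ?oner_neq0// subnn scale1r.
have [|//|b b0 bE] := IHM.
  by move=> m /andP[km mM]; apply: chain; rewrite km ltnW.
exists (M.+1%:R * b); first by rewrite mulf_neq0// pnatr_eq0.
rewrite subSn// derivSn chain; last by lia.
by rewrite derivnZ bE scalerA.
Qed.

Lemma chain_decreasing_roots (R : realType) (M k : nat) (y : nat -> nat -> R) :
  strictly_decreasing k (y k) ->
  (forall m, (k <= m < M)%N ->
     (row_poly m.+1 (y m.+1))^`() = m.+1%:R *: row_poly m (y m)) ->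
  (k <= M)%N ->
  decreasing_roots k (row_poly M (y M))^`(M - k) (y k).
Proof.
move=> dec chain kM; split=> // u.
have [b b0 ->] := derivn_row_poly_chain chain kM.
by rewrite rootZ//; split=> /root_row_poly.
Qed.

(** * The deformed lattice *)

Lemma lattice_interlaces (R : realType) (N : nat) (z a : nat -> R)
    (y : nat -> nat -> R) k :
  deformed_corners_lattice N z a y -> (1 <= k < N)%N ->
  interlaces k.+1 (y k.+1) (y k).
Proof. by case=> _ il _ kN i iK; apply: il; lia. Qed.

Lemma lattice_decreasing (R : realType) (N : nat) (z a : nat -> R)
    (y : nat -> nat -> R) k :
  deformed_corners_lattice N z a y ->
  strictly_decreasing N z -> (1 <= k <= N)%N -> strictly_decreasing k (y k).
Proof.
move=> lat dec kN; have [yz _ _] := lat.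
case: (ltngtP k N) => [lt_kN||eq_kN].
- apply: (@interlaces_strictly_decreasing_lower _ k.+1 (y k.+1)).
  by apply: lattice_interlaces lat _; lia.
- by lia.
- by move=> j jk; rewrite eq_kN !yz; [apply: dec|..]; lia.
Qed.

(** If level [k-1] consists of the critical points of level [k], the interaction
    of level [k] with itself cancels the one with level [k-1], and the lattice
    equation becomes a relation between levels [k] and [k+1] alone. For [k = 1]
    both interactions are empty sums, which starts the induction. *)
Lemma lattice_root_Dop (R : realType) (N : nat) (z a : nat -> R)
    (y : nat -> nat -> R) k :
  deformed_corners_lattice N z a y ->
  strictly_decreasing N z -> (1 <= k < N)%N ->
  ((1 < k)%N -> (row_poly k (y k))^`() = k%:R *: row_poly k.-1 (y k.-1)) ->
  forall i, (1 <= i <= k)%N ->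
  root (Dop (a k - a k.+1) (row_poly k.+1 (y k.+1))) (y k i).
Proof.
move=> lat dec kN Dk i ik; rewrite root_Dop_row_poly; last first.
  by move=> j jk; apply: interlaces_neq (lattice_interlaces lat kN) _ jk; lia.
case: (lat) => _ _ /(_ k i ik ltac:(lia)).
suff -> : \sum_(1 <= p < k) (y k i - y k.-1 p)^-1
    = 2 * \sum_(1 <= j < k.+1 | j != i) (y k i - y k j)^-1.
  by move=> eqn; apply/eqP; lra.
have [k1|k_gt1] := leqP k 1.
  rewrite [LHS]big_geq// big_nat_cond big1 ?mulr0// => j; lia.
apply: sum_inv_at_root (Dk k_gt1) ik; last by rewrite pnatr_eq0; lia.
by apply: lattice_decreasing lat dec _; lia.
Qed.

(** Upward induction on the level: the relation between levels [k-1] and [k]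
    reduces the equations at level [k] to the vanishing of the derivative of level
    [k+1] at the entries of level [k]. *)
Lemma lattice_deriv (R : realType) (N : nat) (z a : nat -> R)
    (y : nat -> nat -> R) M :
  deformed_corners_lattice N z a y ->
  strictly_decreasing N z -> (M <= N)%N ->
  (forall k, (1 <= k < M)%N -> a k = a k.+1) ->
  forall k, (1 <= k < M)%N ->
  (row_poly k.+1 (y k.+1))^`() = k.+1%:R *: row_poly k (y k).
Proof.
move=> lat dec MN aE; elim=> [//|k IHk] kM.
apply: deriv_row_poly_eq; first by apply: lattice_decreasing lat dec _; lia.
move=> i ik; have := lattice_root_Dop lat dec (k := k.+1) ltac:(lia) _ ik.
rewrite /Dop aE// subrr scale0r addr0; apply=> k_gt1.
by apply: IHk; lia.
Qed.

Theorem proposition5p14 (R : realType) (N : nat) (z a v : nat -> R) (c : R)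
    (PN PN1 : {poly R}) (y : nat -> nat -> R)
    (hN : (2 <= N)%N)
    (hz : strictly_decreasing N z)
    (ha : forall k : nat, (1 <= k <= N.-1)%N -> a k = a 1%N)
    (hc : c = a N.-1 - a N)
    (hPN : PN = row_poly N z)
    (hv : interlacing_roots N z c v)
    (hPN1 : PN1 = row_poly N.-1 v)
    (hy : deformed_corners_lattice N z a y) :
  [/\ forall k : nat, (1 <= k <= N.-1)%N ->
        decreasing_roots k (PN1^`(N.-1 - k)) (y k),
      corners_lattice N.-1 v y
    & c = 0 -> PN1 = N%:R^-1 *: PN^`() /\ corners_lattice N z y].
Proof.
have NE : N.-1.+1 = N by lia.
have [yz _ _] := hy.
have yN : row_poly N (y N) = row_poly N z := eq_row_poly yz.
have aE k : (1 <= k < N.-1)%N -> a k = a k.+1.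
  by move=> kN; rewrite ha ?(ha k.+1)//; lia.
have chain := lattice_deriv hy hz (leq_pred N) aE.
have yv i : (1 <= i <= N.-1)%N -> y N.-1 i = v i.
  move=> iN; apply: (@interlacing_root_unique _ N z _ _ c); last by lia.
  - move=> j jN; have := lattice_interlaces hy (k := N.-1) ltac:(lia).
    by move=> /(_ j); rewrite NE !yz; [apply|..]; lia.
  - by move=> j /hv[].
  - move=> j jN; have := lattice_root_Dop hy hz (k := N.-1) ltac:(lia).
    rewrite NE yN -hc; apply; last by lia.
    by move=> N1; have := chain N.-1.-1 ltac:(lia); rewrite (ltn_predK N1).
  - by move=> j /hv[].
have vy : row_poly N.-1 v = row_poly N.-1 (y N.-1) by rewrite (eq_row_poly yv).
have dec k : (1 <= k <= N)%N -> strictly_decreasing k (y k).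
  by move=> kN; exact: (lattice_decreasing hy hz kN).
have roots1 k : (1 <= k <= N.-1)%N ->
    decreasing_roots k (PN1^`(N.-1 - k)) (y k).
  move=> kN; rewrite hPN1 vy; apply: chain_decreasing_roots; last by lia.
    by apply: dec; lia.
  by move=> m mN; apply: chain; lia.
split=> //.
  split=> // [j jN|k kN]; last by rewrite -hPN1; apply: roots1; lia.
  by rewrite -!yv; [apply: dec|..]; lia.
move=> c0; have aE' k : (1 <= k < N)%N -> a k = a k.+1.
  move=> kN; case: (ltngtP k N.-1) => [kN1||kN1]; [by apply: aE; lia|by lia|].
  by rewrite kN1 NE; apply/eqP; rewrite -subr_eq0 -hc c0.
have chain' := lattice_deriv hy hz (leqnn N) aE'.
split.
  have := chain' N.-1 ltac:(lia); rewrite NE => DN.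
  rewrite hPN1 vy hPN -yN DN.
  by rewrite scalerA mulVf ?scale1r// pnatr_eq0; lia.
split=> // k kN; rewrite -yN; apply: chain_decreasing_roots; last by lia.
  by apply: dec; lia.
by move=> m mN; apply: chain'; lia.
Qed.
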